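(* Let $G$ be a connected non-compact real semisimple Lie group, $\sigma$ an involutive automorphism of $G$, and $H$ a closed subgroup of $G$ with $(G^\sigma)_0\subset H\subset G^\sigma$. Let $\theta,\theta'$ be two Cartan involutions of $G$, both commuting with $\sigma$, and let $y\in\exp\mathfrak h_0$ satisfy $\theta'=\operatorname{Ad}(y)\circ\theta\circ\operatorname{Ad}(y^{-1})$ on $\mathfrak g_0$. Put $K=G^\theta$ and $K'=G^{\theta'}$. Let $\mathfrak a_0'$ be a maximal abelian subspace of $\mathfrak p_0'\cap\mathfrak q_0$, put $\mathfrak a_0=\operatorname{Ad}(y^{-1})\mathfrak a_0'$ (which is a maximal abelian subspace of $\mathfrak p_0\cap\mathfrak q_0$), $A'=\exp\mathfrak a_0'$ and $A=\exp\mathfrak a_0$. Then $$N_{K'\times H}(A')=y*N_{K\times H}(A)\quad\text{and}\quad Z_{K'\times H}(A')=y*Z_{K\times H}(A).$$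
   Context: For an automorphism $\nu$ of $G$, $G^\nu=\{g\in G:\nu(g)=g\}$, and $(G^\nu)_0$ is its identity component. $\mathfrak g_0,\mathfrak h_0$ are the Lie algebras of $G,H$; differentials of $\sigma,\theta,\theta'$ on $\mathfrak g_0$ are denoted by the same letters. $\mathfrak q_0=\{X\in\mathfrak g_0:\sigma(X)=-X\}$, $\mathfrak p_0=\{X\in\mathfrak g_0:\theta(X)=-X\}$, $\mathfrak p_0'=\{X\in\mathfrak g_0:\theta'(X)=-X\}$. The groups $K=G^\theta$ and $K'=G^{\theta'}$ are connected and are maximal compact subgroups of $G$. It is known that for any two Cartan involutions $\theta,\theta'$ commuting with $\sigma$ an element $y$ as in the statement exists. $G\times G$ acts on $G$ by $(g_1,g_2)\cdot x=g_1xg_2^{-1}$. $G$ acts on $G\times G$ by $g*(x_1,x_2)=(gx_1g^{-1},gx_2g^{-1})$, and $g*S=\{g*s:s\in S\}$ for $S\subset G\times G$. For a subgroup $L\subset G$ and a subset $C\subset G$: $N_{L\times H}(C)=\{(k,h)\in L\times H:(k,h)\cdot C=C\}$, $Z_{L\times H}(C)=\{(k,h)\in L\times H:(k,h)\cdot c=c\ \text{for all } c\in C\}$. *)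

(* Defs.v *)
From HB Require Import structures.
From mathcomp Require Import all_boot all_order all_algebra.
From mathcomp Require Import all_classical all_reals all_analysis.
Set Implicit Arguments.
Unset Strict Implicit.
Unset Printing Implicit Defensive.
Import Order.TTheory GRing.Theory Num.Theory.
Import numFieldNormedType.Exports.
Local Open Scope classical_set_scope.
Local Open Scope ring_scope.

Section SmoothMaps.
Context {R : realType}.

(* [Ck k U f] is meant for open [U].  On finite-dimensional spaces, [f] is
   C^(k+1) iff it is differentiable and its directional derivatives are C^k. *)
Fixpoint Ck {V W : normedModType R} (k : nat) (U : set V) (f : V -> W) : Prop :=
  match k with
  | 0 => forall x, U x -> {for x, continuous f}
  | k'.+1 => (forall x, U x -> differentiable f x) /\
             (forall v : V, Ck k' U (fun x => 'd f x v))
  end.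

Definition smooth_on {V W : normedModType R} (U : set V) (f : V -> W) : Prop :=
  forall k, Ck k U f.

(* [cmap] and [cinv] are total functions; only their values on [cdom] and
   [cimg] matter. *)
Record chart (M : topologicalType) (V : normedModType R) := Chart {
  cdom : set M;
  cmap : M -> V;
  cinv : V -> M }.

Definition cimg (M : topologicalType) (V : normedModType R) (c : chart M V) :
  set V := cmap c @` cdom c.

Definition is_chart (M : topologicalType) (V : normedModType R)
    (c : chart M V) : Prop :=
  [/\ open (cdom c), open (cimg c),
      (forall x, cdom c x -> cinv c (cmap c x) = x),
      (forall x, cdom c x -> {for x, continuous (cmap c)}) &
      (forall v, cimg c v -> {for v, continuous (cinv c)})].

Definition id_chart (V : normedModType R) : chart V V := Chart setT id id.

Definition prod_chart (M N : topologicalType) (V W : normedModType R)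
    (c : chart M V) (d : chart N W) : chart (M * N)%type (V * W)%type :=
  Chart (cdom c `*` cdom d)
    (fun x => (cmap c x.1, cmap d x.2)) (fun v => (cinv c v.1, cinv d v.2)).

Definition prod_atlas (M N : topologicalType) (V W : normedModType R)
    (A : set (chart M V)) (B : set (chart N W)) :
    set (chart (M * N)%type (V * W)%type) :=
  [set prod_chart cd.1 cd.2 | cd in A `*` B].

Definition smooth_map (M N : topologicalType) (V W : normedModType R)
    (A : set (chart M V)) (B : set (chart N W)) (f : M -> N) : Prop :=
  continuous f /\
  forall c d, A c -> B d ->
    smooth_on (cimg c `&` (f \o cinv c) @^-1` cdom d) (cmap d \o f \o cinv c).

End SmoothMaps.

HB.mixin Record isLieGroup (R : realType) (n : nat) G
    of Group G & Topological G := {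
  atlas : set (chart G 'rV[R]_n);
  atlas_chart : forall c, atlas c -> is_chart c;
  atlas_cover : forall x : G, exists2 c, atlas c & cdom c x;
  atlas_compat : smooth_map atlas atlas (@idfun G);
  lie_hausdorff : hausdorff_space G;
  lie_second_countable : @second_countable G;
  lie_mul_smooth : smooth_map (prod_atlas atlas atlas) atlas
                     (fun x : G * G => (x.1 * x.2)%g);
  lie_inv_smooth : smooth_map atlas atlas (fun x : G => (x^-1)%g) }.

#[short(type="lieGroupType")]
HB.structure Definition LieGroup (R : realType) (n : nat) :=
  {G of isLieGroup R n G & Group G & Topological G}.

Section LieGroups.
Context {R : realType} {n : nat} (G : lieGroupType R n).
Implicit Types (X Y : 'rV[R]_n) (I U : {vspace 'rV[R]_n}).
Implicit Types (nu : G -> G) (H : set G).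

Definition gatlas : set (chart G 'rV[R]_n) := @atlas R n G.

(* The Lie algebra of G is its tangent space at 1, identified with R^n by a
   chart around 1 chosen once and for all; another choice of chart gives an
   isomorphic Lie algebra. *)
Definition chart1 : chart G 'rV[R]_n :=
  sval (cid2 (@atlas_cover R n G 1%g)).

(* for [f 1 = 1] *)
Definition differential (f : G -> G) : 'rV[R]_n -> 'rV[R]_n :=
  'd (cmap chart1 \o f \o cinv chart1) (cmap chart1 1%g).

Definition Ad (g : G) : 'rV[R]_n -> 'rV[R]_n :=
  differential (fun x => (g * x * g^-1)%g).

(* [X, Y] = ad X Y, where ad is the differential at 1 of Ad *)
Definition bracket X Y : 'rV[R]_n :=
  'd (fun v : 'rV[R]_n => Ad (cinv chart1 v) Y : 'rV[R]_n)
     (cmap chart1 1%g) X.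

Definition killing X Y : R :=
  \tr (lin1_mx (bracket X) *m lin1_mx (bracket Y)).

Definition lie_ideal I : Prop :=
  forall X Y, Y \in I -> bracket X Y \in I.

(* By bilinearity, brackets of basis vectors span [U, U]. *)
Definition derived_alg U : {vspace 'rV[R]_n} :=
  <<[seq bracket X Y | X <- vbasis U, Y <- vbasis U]>>%VS.

Definition solvable_alg U : Prop := exists k, iter k derived_alg U = 0%VS.

Definition semisimple : Prop :=
  forall I, lie_ideal I -> solvable_alg I -> I = 0%VS.

(* gamma (t) = exp (t X) *)
Definition one_parameter (gamma : R^o -> G) X : Prop :=
  [/\ (forall s t : R, gamma (s + t) = (gamma s * gamma t)%g),
      smooth_map [set id_chart R^o] gatlas gamma &
      derive1 (cmap chart1 \o gamma) 0 = X].

(* the set exp S *)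
Definition exp_set (S : set 'rV[R]_n) : set G :=
  [set g | exists2 X, S X & exists2 gamma, one_parameter gamma X & g = gamma 1].

(* the Lie algebra {X | exp (t X) \in H for all t} of a closed subgroup H *)
Definition lie_subalgebra H : set 'rV[R]_n :=
  [set X | exists2 gamma, one_parameter gamma X & forall t, H (gamma t)].

Definition is_subgroup H : Prop :=
  [/\ H 1%g, (forall x y, H x -> H y -> H (x * y)%g) &
      (forall x, H x -> H (x^-1)%g)].

(* the identity map is allowed *)
Definition involutive_automorphism nu : Prop :=
  [/\ {morph nu : x y / (x * y)%g}, smooth_map gatlas gatlas nu & involutive nu].

Definition cartan_involution nu : Prop :=
  involutive_automorphism nu /\
  forall X, X != 0 -> 0 < - killing X (differential nu X).

Definition fixed nu : set G := [set g | nu g = g].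

Definition anti_fixed nu : set 'rV[R]_n := [set X | differential nu X = - X].

Definition abelian_subspace U : Prop :=
  forall X Y, X \in U -> Y \in U -> bracket X Y = 0.

Definition maximal_abelian_subspace (S : set 'rV[R]_n) U : Prop :=
  [/\ [set` U] `<=` S, abelian_subspace U &
      forall U', [set` U'] `<=` S -> abelian_subspace U' -> (U <= U')%VS ->
        U' = U].

Definition act (g : G * G) (x : G) : G := (g.1 * x * g.2^-1)%g.

Definition star (g : G) (x : G * G) : G * G :=
  (g * x.1 * g^-1, g * x.2 * g^-1)%g.

Definition normalizer (L H C : set G) : set (G * G) :=
  [set g | (L `*` H) g /\ act g @` C = C].

Definition centralizer (L H C : set G) : set (G * G) :=
  [set g | (L `*` H) g /\ forall c, C c -> act g c = c].

End LieGroups.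

(* Main.v *)
(* A smooth homomorphism of a connected Lie group is determined by its
   differential.  If phi and psi have the same differential at 1, then
   f(x) = phi(x) psi(x)^-1 has zero differential at 1, because by the chain rule
   that differential depends on psi only through d psi, and it is zero for
   psi = phi.  As f(x w) = phi(x) f(w) psi(x)^-1, the differential of f is zero
   everywhere, so f = 1 near 1 and the closed subgroup {phi = psi} is open.  The
   same computation shows that a one-parameter subgroup is determined by its
   tangent vector.  Hence y lies in H, and theta' = Int(y) theta Int(y)^-1 on G,
   so K' = y K y^-1; together with exp(Ad(y) X) = y exp(X) y^-1 this makes
   conjugation by y carry (K, H, A) to (K', H, A'). *)
From HB Require Import structures.
Require Import Defs.
From mathcomp Require Import all_boot all_order all_algebra.
From mathcomp Require Import all_classical all_reals all_analysis.
Import numFieldNormedType.Exports.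
Local Open Scope classical_set_scope.
Local Open Scope ring_scope.

Set Implicit Arguments.
Unset Strict Implicit.
Unset Printing Implicit Defensive.
Import Order.TTheory GRing.Theory Num.Theory.

(** * Calculus of [Ck] maps on open sets of normed spaces *)

Section Calculus.
Context {R : realType}.
Implicit Types V W Z : normedModType R.

(** A differential is the unique continuous linear map in a first-order expansion, and the expansion
    sees only the germ at [x]. This lets a chart be cancelled against its inverse, which is possible
    only near a point. *)
Lemma near_eq_is_diff V W (f g : V -> W) (x : V) :
  {near x, f =1 g} -> differentiable f x -> is_diff x g ('d f x).
Proof.
move=> fg df.
have E : g \o shift x = cst (g x) + 'd f x +o_ (0 : V) id.
  have := diff_locally df.
  move=> /eqaddoP fo; apply/eqaddoP => e e0.
  have fgx : f x = g x := nbhs_singleton fg.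
  have fg0 : \forall h \near (0 : V), f (h + x) = g (h + x).
    by move: fg; rewrite (near_shift 0 x) /= subr0.
  move: (fo e e0) fg0; apply: filterS2 => h /=.
  by rewrite !fctE /= fgx => ? <-.
have dE : 'd g x = 'd f x :> (V -> W).
  by apply: diff_unique => //; exact: diff_continuous.
apply: DiffDef => //; apply/diff_locallyP; rewrite dE; split=> //.
exact: diff_continuous.
Qed.

Lemma Ck_le V W k (U : set V) (f : V -> W) : Ck k.+1 U f -> Ck k U f.
Proof.
elim: k f => [|k IH] f /=.
  by move=> [df _] x Ux; apply: differentiable_continuous; exact: df.
by move=> [df dfC]; split=> // v; apply: IH; exact: dfC.
Qed.

(** As [U] is open, equality on [U] is equality of germs at its points, so the directional
    derivatives agree on [U] too and the induction continues. *)
Lemma eq_Ck V W k (U : set V) (f g : V -> W) : open U ->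
  (forall x, U x -> f x = g x) -> Ck k U f -> Ck k U g.
Proof.
move=> oU; elim: k f g => [|k IH] f g fg.
  move=> /= cf x Ux.
  have /cvg_trans : g @ x --> f @ x by apply: near_eq_cvg;
    apply: filterS (open_nbhs_nbhs (conj oU Ux)) => z Uz; apply: fg.
  by move/(_ _ (cf x Ux)); rewrite fg.
have fgn x : U x -> {near x, f =1 g}.
  by move=> Ux; apply: filterS (open_nbhs_nbhs (conj oU Ux)) => z Uz; apply: fg.
move=> [df dfC]; split.
  by move=> x Ux; have [] := near_eq_is_diff (fgn _ Ux) (df _ Ux).
move=> v; apply: IH (dfC v) => x Ux.
have [_ E] := near_eq_is_diff (fgn _ Ux) (df _ Ux).
exact: esym (congr1 (fun h => h v) E).
Qed.

Lemma Ck_bigcup V W k (I : Type) (D : set I) (U : I -> set V) (f : V -> W) :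
  (forall i, D i -> Ck k (U i) f) -> Ck k (\bigcup_(i in D) U i) f.
Proof.
elim: k f => [|k IH] f /= fC; first by move=> x [i Di Ux]; exact: (fC i).
split=> [x [i Di Ux]|v]; first by case: (fC i Di) => + _; apply.
by apply: IH => i Di; case: (fC i Di).
Qed.

Lemma Ck_sub V W k (U U' : set V) (f : V -> W) :
  U' `<=` U -> Ck k U f -> Ck k U' f.
Proof.
move=> sub; elim: k f => [|k IH] f /=; first by move=> fC x /sub; apply: fC.
by move=> [df dfC]; split=> [x /sub /df//|v]; apply: IH.
Qed.

Lemma Ck_cst V W k (U : set V) (w : W) : Ck k U (fun _ => w).
Proof.
elim: k w => [|k IH] w /=; first by move=> x _; exact: cst_continuous.
split=> [x _|v]; first exact: differentiable_cst.
by under eq_fun do rewrite diff_cst; apply: IH.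
Qed.

Lemma CkD V W k (U : set V) (f g : V -> W) : open U ->
  Ck k U f -> Ck k U g -> Ck k U (fun x => f x + g x).
Proof.
move=> oU; elim: k f g => [|k IH] f g /=.
  by move=> fC gC x Ux; apply: continuousD; [exact: fC|exact: gC].
move=> [df dfC] [dg dgC]; split=> [x Ux|v].
  by apply: differentiableD; [exact: df|exact: dg].
apply: eq_Ck (IH _ _ (dfC v) (dgC v)) => // x Ux.
exact: esym (congr1 (fun h => h v) (diffD (df _ Ux) (dg _ Ux))).
Qed.

Lemma Ck_sum V W k (U : set V) (I : Type) (r : seq I) (f : I -> V -> W) :
  open U -> (forall i, Ck k U (f i)) -> Ck k U (fun x => \sum_(i <- r) f i x).
Proof.
move=> oU fC; elim: r => [|i r IH].
  by under eq_fun do rewrite big_nil; exact: Ck_cst.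
by under eq_fun do rewrite big_cons; exact: CkD.
Qed.

(** Leibniz rule, obtained from the differential of scaling as a continuous bilinear map, composed
    with a pair. *)
Lemma is_diff_scale V W (h : V -> R^o) (z : V -> W) (x : V) :
  differentiable h x -> differentiable z x ->
  is_diff x (fun u => h u *: z u) (fun v => h x *: 'd z x v + 'd h x v *: z x).
Proof.
move=> dh dz.
have bl : bilinear_for
    (GRing.Scale.Law.clone _ _ *:%R _) (GRing.Scale.Law.clone _ _ *:%R _)
    (@GRing.scale R W : R^o -> W -> W).
  by split=> [w|a] b u v; rewrite /= ?scalerDl ?scalerDr !scalerA// mulrC.
pose sM := bilinear_isBilinear.Build _ _ _ _ _ _ _ bl.
pose sL : {bilinear R^o -> W -> W} := HB.pack (@GRing.scale R W : R^o -> W -> W) sM.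
have sc : continuous (fun p : R^o * W => sL p.1 p.2) by move=> p; exact: scale_continuous.
have dp := differentiable_pair dh dz.
have ds := differentiable_bilin (h x, z x) sc.
apply: DiffDef; first exact: (differentiable_comp dp ds).
by rewrite (diff_comp dp ds) (diff_bilin _ sc) (diff_pair dh dz).
Qed.

Lemma CkZ V W k (U : set V) (h : V -> R^o) (z : V -> W) : open U ->
  Ck k U h -> Ck k U z -> Ck k U (fun x => h x *: z x).
Proof.
move=> oU; elim: k h z => [|k IH] h z.
  by move=> hC zC x Ux; apply: continuousZ; [exact: hC|exact: zC].
(* The derivative contains [h] and [z] undifferentiated, so both are also needed at level [k]. *)
move=> hS zS; have hk := Ck_le hS; have zk := Ck_le zS.
case: hS zS => [dh dhC] [dz dzC]; split=> [x Ux|v].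
  by have [] := is_diff_scale (dh _ Ux) (dz _ Ux).
apply: (@eq_Ck _ _ _ _ (fun x => h x *: 'd z x v + 'd h x v *: z x)) => //.
  move=> x Ux; have [_ E] := is_diff_scale (dh _ Ux) (dz _ Ux).
  exact: esym (congr1 (fun h => h v) E).
by apply: CkD => //; apply: IH => //; [exact: dzC|exact: dhC].
Qed.

Lemma Ck_linear V W Z k (U : set V) (f : V -> W) (l : {linear W -> Z}) :
  open U -> continuous l -> Ck k U f -> Ck k U (l \o f).
Proof.
move=> oU lc; elim: k f => [|k IH] f.
  by move=> fC x Ux; apply: continuous_comp; [exact: fC|exact: lc].
move=> [df dfC]; split=> [x Ux|v].
  by apply: differentiable_comp; [exact: df|exact: linear_differentiable].
apply: eq_Ck (IH _ (dfC v)) => // x Ux.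
rewrite diff_comp ?diff_lin//; [exact: df|exact: linear_differentiable].
Qed.

Lemma Ck_pair V W Z k (U : set V) (f : V -> W) (g : V -> Z) : open U ->
  Ck k U f -> Ck k U g -> Ck k U (fun x => (f x, g x)).
Proof.
move=> oU; elim: k f g => [|k IH] f g.
  by move=> fC gC x Ux; apply: cvg_pair; [exact: fC|exact: gC].
move=> [df dfC] [dg dgC]; split=> [x Ux|v].
  by apply: differentiable_pair; [exact: df|exact: dg].
apply: eq_Ck (IH _ _ (dfC v) (dgC v)) => // x Ux.
exact: esym (congr1 (fun h => h v) (diff_pair (df _ Ux) (dg _ Ux))).
Qed.

End Calculus.

(** * Coordinates, the chain rule for [Ck], and maps with zero differential *)

Section FiniteDimension.
Context {R : realType}.
Implicit Types V W Z : normedModType R.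

(** Finite dimension in the form that the chain rule uses: a finite family with continuous linear
    coordinates. It passes directly to products. *)
Definition has_coordinates W : Prop :=
  exists (I : finType) (b : I -> W) (l : I -> {linear W -> R^o}),
    (forall i, continuous (l i)) /\ forall w, w = \sum_i l i w *: b i.

Definition entry m n (i : 'I_m) (j : 'I_n) (M : 'M[R]_(m, n)) : R^o := M i j.

Fact entry_is_linear m n (i : 'I_m) (j : 'I_n) : linear (@entry m n i j).
Proof. by move=> a u v; rewrite /entry !mxE. Qed.

HB.instance Definition _ m n (i : 'I_m) (j : 'I_n) :=
  GRing.isLinear.Build _ _ _ _ (@entry m n i j) (entry_is_linear i j).

Lemma row_has_coordinates n : has_coordinates 'rV[R]_n.
Proof.
exists 'I_n, (fun j => delta_mx 0 j),
  (fun j => (@entry 1 n ord0 j : {linear _ -> _})).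
by split=> [j|w]; [exact: coord_continuous|exact: row_sum_delta].
Qed.

Lemma prod_has_coordinates W Z :
  has_coordinates W -> has_coordinates Z -> has_coordinates (W * Z)%type.
Proof.
move=> [I [b [l [lc lE]]]] [J [c [m [mc mE]]]].
exists (I + J)%type,
  (fun k : I + J => match k with inl i => (b i, 0) | inr j => (0, c j) end),
  (fun k : I + J => match k return {linear (W * Z)%type -> R^o} with
     | inl i => l i \o fst
     | inr j => m j \o snd end).
split=> [[i|j] p|[w z]].
- by apply: continuous_comp; [exact: cvg_fst|exact: lc].
- by apply: continuous_comp; [exact: cvg_snd|exact: mc].
rewrite big_sumType /=.
rewrite {1}(lE w) {1}(mE z).
have E (r : W) (s : Z) : (r, s) = (r, 0) + (0, s) :> W * Z.
  by congr pair; rewrite ?addr0 ?add0r.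
rewrite E; congr (_ + _).
  rewrite (big_morph (fun r : W => (r, 0 : Z)) (id1 := 0) (op1 := +%R)) //.
    by apply: eq_bigr => i _; congr pair; rewrite scaler0.
  by move=> u v; congr pair; rewrite addr0.
rewrite (big_morph (fun r : Z => (0 : W, r)) (id1 := 0) (op1 := +%R)) //.
  by apply: eq_bigr => i _; congr pair; rewrite scaler0.
by move=> u v; congr pair; rewrite addr0.
Qed.

(* With b a basis of W and l its dual basis, d(g o f)(x) v is the sum over i of
   l_i (d f(x) v) d g(f x) b_i, a sum of products of C^k functions. *)
Lemma Ck_comp V W Z k (U : set V) (U' : set W) (f : V -> W) (g : W -> Z) :
  has_coordinates W -> open U -> (forall x, U x -> U' (f x)) ->
  Ck k U f -> Ck k U' g -> Ck k U (g \o f).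
Proof.
move=> [I [b [l [lc lE]]]] oU fU; elim: k g => [|k IH] g.
  move=> fC gC x Ux; apply: continuous_comp; first exact: fC.
  exact: gC _ (fU _ Ux).
move=> fS; have fk := Ck_le fS; case: fS => df dfC [dg dgC].
split=> [x Ux|v].
  by apply: differentiable_comp; [exact: df|exact: dg _ (fU _ Ux)].
apply: (@eq_Ck _ _ _ _ _ (fun x => \sum_i (l i \o (fun x => 'd f x v)) x *:
                             ((fun w => 'd g w (b i)) \o f) x)) => //.
  move=> x Ux.
  have E : 'd g (f x) ('d f x v) = 'd (g \o f) x v.
    exact: esym (congr1 (fun h => h v) (diff_comp (df _ Ux) (dg _ (fU _ Ux)))).
  rewrite -E [in RHS](lE ('d f x v)) linear_sum; apply: eq_bigr => i _.
  by rewrite linearZ.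
apply: Ck_sum => // i; apply: CkZ => //; first exact: (Ck_linear oU (lc i) (dfC v)).
exact: (IH _ fk (dgC (b i))).
Qed.

(** The segment from [x] to [z] stays in the ball, and each coordinate of [f] has zero derivative
    along it. The mean value theorem concerns scalar functions, hence the passage to coordinates. *)
Lemma diff0_cst_ball V m (f : V -> 'rV[R]_m) (x : V) (e : R) :
  (forall z, ball x e z -> differentiable f z /\ forall v, 'd f z v = 0) ->
  forall z, ball x e z -> f z = f x.
Proof.
move=> df0 z xz; apply/rowP => i.
pose p (t : R^o) : V := x + t *: (z - x).
have dp t : differentiable p t.
  apply: differentiableD; first exact: differentiable_cst.
  exact: differentiableZl.
have pball (t : R) : t \in `[0, 1]%R -> ball x e (p t).
  rewrite in_itv /= => /andP[t0 t1]; move: xz; rewrite -ball_normE /= => xz.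
  rewrite opprD addNKr normrN normrZ ger0_norm// distrC.
  by apply: le_lt_trans xz; rewrite ler_piMl.
pose q : R -> R := fun t => f (p t) 0 i.
have dq (t : R) : t \in `[0, 1]%R -> is_derive (t : R^o) 1 (q : R^o -> R^o) 0.
  move=> /pball pt; have [df f0] := df0 _ pt.
  have dfp := differentiable_comp (dp t) df.
  have dl := differentiable_coord (f (p t)) 0 i.
  have dq := differentiable_comp dfp dl.
  apply: DeriveDef; first exact: diff_derivable.
  rewrite deriveE// (diff_comp dfp dl) /= (diff_comp (dp t) df) /= f0.
  by rewrite linear0.
have qc : {within `[0, 1], continuous q}.
  by apply: derivable_within_continuous => t /dq[].
have qd (t : R) : t \in `]0, 1[%R -> is_derive t 1 q 0.
  by move=> t01; apply: dq; apply: subset_itv_oo_cc t01.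
have [c _] := @MVT_segment R q (fun=> 0) 0 1 ler01 qd qc.
rewrite mul0r => /eqP; rewrite subr_eq0 => /eqP.
by rewrite /q /p scale1r scale0r addr0 addrC subrK.
Qed.

End FiniteDimension.

(** * Smooth maps between spaces with atlases *)

Section SmoothMapTheory.
Context {R : realType}.
Implicit Types (M N P : topologicalType) (V W Z : normedModType R).

Lemma open_setX M N (A : set M) (B : set N) :
  open A -> open B -> open (A `*` B).
Proof.
move=> oA oB; rewrite openE => -[x y] [/= Ax By].
by exists (A, B) => //; split; exact: open_nbhs_nbhs.
Qed.

Definition is_atlas M V (A : set (chart M V)) : Prop :=
  (forall c, A c -> is_chart c) /\ forall x, exists2 c, A c & cdom c x.

Lemma id_is_atlas V : is_atlas [set id_chart V].
Proof.
split=> [_ ->|x]; last by exists (id_chart V).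
split=> //=; [exact: openT| |by move=> ? _; exact: cvg_id|by move=> ? _; exact: cvg_id].
rewrite (_ : cimg _ = setT); first exact: openT.
by apply/seteqP; split=> // v _; exists v.
Qed.

Lemma prod_is_atlas M N V W (A : set (chart M V)) (B : set (chart N W)) :
  is_atlas A -> is_atlas B -> is_atlas (prod_atlas A B).
Proof.
move=> [Ac Acov] [Bc Bcov]; split; last first.
  move=> [x y]; have [c cA cx] := Acov x; have [d dB dy] := Bcov y.
  by exists (prod_chart c d) => //; exists (c, d).
move=> _ [[c d] /= [cA dB] <-].
have [oc oic cK cc ic] := Ac _ cA; have [od oid dK dc idc] := Bc _ dB.
have imgE : cimg (prod_chart c d) = cimg c `*` cimg d.
  apply/seteqP; split=> [_ [[x y] [/= cx dy] <-]|[_ _] [/= [x cx <-] [y dy <-]]].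
    by split; [exists x|exists y].
  by exists (x, y).
split=> /=.
- exact: open_setX.
- by rewrite imgE; exact: open_setX.
- by move=> [x y] [/= cx dy]; rewrite cK// dK.
- move=> [x y] [/= cx dy]; apply: cvg_pair => /=.
    by apply: (@continuous_comp _ _ _ fst (cmap c) (x, y)); [exact: cvg_fst|exact: cc].
  by apply: (@continuous_comp _ _ _ snd (cmap d) (x, y)); [exact: cvg_snd|exact: dc].
- rewrite imgE => -[v w] [/= cv dw]; apply: cvg_pair => /=.
    by apply: (@continuous_comp _ _ _ fst (cinv c) (v, w)); [exact: cvg_fst|exact: ic].
  by apply: (@continuous_comp _ _ _ snd (cinv d) (v, w)); [exact: cvg_snd|exact: idc].
Qed.

(** Continuity of [f] makes the sets on which [smooth_map] tests smoothness open, as the calculus of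
    [Ck] requires. *)
Lemma open_chart_preimage M N V (c : chart M V) (f : M -> N) (D : set N) :
  is_chart c -> continuous f -> open D ->
  open (cimg c `&` (f \o cinv c) @^-1` D).
Proof.
move=> [_ oi _ _ ic] fc oD; rewrite openE => v [cv Dv]; apply: filterI.
  exact: open_nbhs_nbhs.
have fv : {for v, continuous (f \o cinv c)}.
  by apply: continuous_comp; [exact: ic|exact: fc].
by apply: fv; exact: open_nbhs_nbhs.
Qed.

(** A local expression of [g \o f] factors through a chart [e] of the middle space only where [f]
    lands in [e]. The open sets [S e] where this happens cover the domain, and the chain rule
    applies on each of them. *)
Lemma smooth_map_comp M N P V W Z (A : set (chart M V)) (B : set (chart N W))
    (C : set (chart P Z)) (f : M -> N) (g : N -> P) :
  has_coordinates W -> is_atlas A -> is_atlas B -> is_atlas C ->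
  smooth_map A B f -> smooth_map B C g -> smooth_map A C (g \o f).
Proof.
move=> Wfin [Ac _] [Bc Bcov] [Cc _] [fc fS] [gc gS].
have gfc : continuous (g \o f).
  by move=> x; apply: continuous_comp; [exact: fc|exact: gc].
split=> // c d cA dC k.
have [od _ _ _ _] := Cc _ dC.
pose S (e : chart N W) := (cimg c `&` (g \o f \o cinv c) @^-1` cdom d)
  `&` (cimg c `&` (f \o cinv c) @^-1` cdom e).
apply: (@Ck_sub _ _ _ _ (\bigcup_(e in B) S e)).
  move=> v [cv dv]; have [e eB ex] := Bcov (f (cinv c v)).
  by exists e.
apply: Ck_bigcup => e eB.
have [oe _ eK _ _] := Bc _ eB.
have oS : open (S e).
  by apply: openI; apply: open_chart_preimage => //; exact: Ac.
apply: (@eq_Ck _ _ _ _ _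
    ((cmap d \o g \o cinv e) \o (cmap e \o f \o cinv c))) => //.
  by move=> v [_ [_ /= ev]]; rewrite eK.
apply: (@Ck_comp _ _ _ _ _ _ (cimg e `&` (g \o cinv e) @^-1` cdom d)) => //.
- move=> v [[_ /= dv] [_ /= ev]]; split; last by rewrite /= eK.
  by exists (f (cinv c v)).
- by apply: Ck_sub (fS _ _ cA eB k) => v [_ []].
exact: gS.
Qed.

Lemma smooth_map_cst M N V W (A : set (chart M V)) (B : set (chart N W))
  (b : N) : smooth_map A B (fun=> b).
Proof. by split=> [|c d _ _ k]; [exact: cst_continuous|exact: Ck_cst]. Qed.

Lemma smooth_map_pair M N P V W Z (A : set (chart M V)) (B : set (chart N W))
    (C : set (chart P Z)) (f : M -> N) (g : M -> P) :
  is_atlas A -> is_atlas B -> is_atlas C ->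
  smooth_map A B f -> smooth_map A C g ->
  smooth_map A (prod_atlas B C) (fun x => (f x, g x)).
Proof.
move=> [Ac _] [Bc _] [Cc _] [fc fS] [gc gS].
have fgc : continuous (fun x => (f x, g x)).
  by move=> x; apply: cvg_pair; [exact: fc|exact: gc].
split=> // c _ cA [[d e] /= [dB eC] <-] k.
have [od _ _ _ _] := Bc _ dB; have [oe _ _ _ _] := Cc _ eC.
apply: Ck_pair.
- by apply: open_chart_preimage => //; [exact: Ac|exact: open_setX].
- by apply: Ck_sub (fS _ _ cA dB k) => v [cv []].
- by apply: Ck_sub (gS _ _ cA eC k) => v [cv []].
Qed.

End SmoothMapTheory.

(** * Smoothness of products and two-sided translations *)

Section Translations.
Context {R : realType} {n : nat} {G : lieGroupType R n}.
Local Notation atlasG := (@gatlas R n G).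

Lemma gatlas_is_atlas : is_atlas atlasG.
Proof. by split; [exact: atlas_chart|exact: atlas_cover]. Qed.

Lemma smooth_mul (M : topologicalType) (V : normedModType R)
    (A : set (chart M V)) (f g : M -> G) : is_atlas A ->
  smooth_map A atlasG f -> smooth_map A atlasG g ->
  smooth_map A atlasG (fun x => (f x * g x)%g).
Proof.
move=> Aa fS gS; have Ga := gatlas_is_atlas.
apply: (smooth_map_comp _ _ _ _ (smooth_map_pair _ _ _ fS gS) lie_mul_smooth) => //.
  by apply: prod_has_coordinates; exact: row_has_coordinates.
exact: prod_is_atlas.
Qed.

Lemma smooth_id : smooth_map atlasG atlasG id.
Proof. exact: atlas_compat. Qed.

(** One family for left translations ([b = 1]), conjugations ([b = a^-1]) and the maps that move a
    vanishing differential from 1 to another point. *)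
Definition bitranslate (a b x : G) : G := (a * x * b)%g.

Lemma smooth_bitranslate a b : smooth_map atlasG atlasG (bitranslate a b).
Proof.
have Ga := gatlas_is_atlas.
by do 2?apply: smooth_mul => //; exact: smooth_map_cst || exact: smooth_id.
Qed.

End Translations.

(** * Differentials read in the chart at the identity *)

Section CanonicalChart.
Context {R : realType} {n : nat} {G : lieGroupType R n}.
Local Notation atlasG := (@gatlas R n G).
Local Notation chart1 := (@chart1 R n G).
Local Notation toV := (cmap chart1).
Local Notation toG := (cinv chart1).
Implicit Types (V : normedModType R) (phi psi f g : G -> G).

Lemma chart1_atlas : atlasG chart1.
Proof. by rewrite /Defs.chart1; case: cid2. Qed.

Lemma chart1_dom1 : cdom chart1 1%g.
Proof. by rewrite /Defs.chart1; case: cid2. Qed.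

Lemma chart1_is_chart : is_chart chart1.
Proof. exact: atlas_chart chart1_atlas. Qed.

Lemma toVK x : cdom chart1 x -> toG (toV x) = x.
Proof. by have [_ _ + _ _] := chart1_is_chart; apply. Qed.

Lemma toG_continuous x : cdom chart1 x -> {for toV x, continuous toG}.
Proof. by have [_ _ _ _ c] := chart1_is_chart => dx; apply: c; exists x. Qed.

Lemma near_chart1 V (f : V -> G) (v : V) : {for v, continuous f} ->
  cdom chart1 (f v) -> \forall u \near v, cdom chart1 (f u).
Proof.
move=> fc fv; have [oU _ _ _ _] := chart1_is_chart.
by apply: fc; exact: open_nbhs_nbhs.
Qed.

Lemma smooth_differentiable f x : smooth_map atlasG atlasG f ->
  cdom chart1 x -> cdom chart1 (f x) -> differentiable (toV \o f \o toG) (toV x).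
Proof.
move=> [_ /(_ _ _ chart1_atlas chart1_atlas 1%N) [fd _]] xU fxU; apply: fd.
by split; [exists x|rewrite /= toVK].
Qed.

(** The chain rule with [toG \o toV] inserted between [g] and [f]; the insertion is the identity
    only near [v]. The source [V] is later the model space or the real line. *)
Lemma is_diff_smooth_comp V (f : V -> G) g (v : V) :
  {for v, continuous f} -> differentiable (toV \o f) v ->
  smooth_map atlasG atlasG g -> cdom chart1 (f v) -> cdom chart1 (g (f v)) ->
  is_diff v (toV \o (g \o f))
    ('d (toV \o g \o toG) (toV (f v)) \o 'd (toV \o f) v).
Proof.
move=> fc fd gS fU gU.
have gd := smooth_differentiable gS fU gU.
have E := diff_comp fd gd.
rewrite -E; apply: near_eq_is_diff; last exact: differentiable_comp.
by apply: filterS (near_chart1 fc fU) => u fu; rewrite /= toVK.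
Qed.

Definition chart_mul : 'rV[R]_n * 'rV[R]_n -> 'rV[R]_n :=
  toV \o (fun x : G * G => x.1 * x.2)%g \o cinv (prod_chart chart1 chart1).

(** The differential of a product depends on [P] and [Q] only through their values and differentials
    at [v], so a factor can be exchanged for another with the same first-order data. *)
Lemma is_diff_mul V (P Q : V -> G) (v : V) :
  {for v, continuous P} -> {for v, continuous Q} ->
  differentiable (toV \o P) v -> differentiable (toV \o Q) v ->
  cdom chart1 (P v) -> cdom chart1 (Q v) -> cdom chart1 (P v * Q v)%g ->
  is_diff v (toV \o (fun u => P u * Q u)%g)
    (fun u => 'd chart_mul (toV (P v), toV (Q v))
                ('d (toV \o P) v u, 'd (toV \o Q) v u)).
Proof.
move=> Pc Qc Pd Qd PU QU PQU.
have md : differentiable chart_mul (toV (P v), toV (Q v)).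
  have cA : prod_atlas atlasG atlasG (prod_chart chart1 chart1).
    by exists (chart1, chart1) => //; split; exact: chart1_atlas.
  have [_ S] := @lie_mul_smooth R n G.
  have [+ _] := S _ _ cA chart1_atlas 1%N.
  apply; split; first by exists (P v, Q v).
  by rewrite /= !toVK.
have pd := differentiable_pair Pd Qd.
have mpd := differentiable_comp pd md.
have E : {near v, chart_mul \o (fun y => ((toV \o P) y, (toV \o Q) y))
    =1 toV \o (fun u => P u * Q u)%g}.
  apply: filterS2 (near_chart1 Pc PU) (near_chart1 Qc QU) => u Pu Qu.
  by rewrite /chart_mul /= !toVK.
apply: is_diff_eq (near_eq_is_diff E mpd) _.
apply: funext => u.
have E1 := congr1 (fun h => h u) (diff_comp pd md).
have E2 := congr1 (fun h => h u) (diff_pair Pd Qd).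
exact: etrans E1 (congr1 ('d chart_mul (toV (P v), toV (Q v))) E2).
Qed.

End CanonicalChart.

(** * Maps into the group with zero differential *)

Section Rigidity.
Context {R : realType} {n : nat} {G : lieGroupType R n}.
Local Notation atlasG := (@gatlas R n G).
Local Notation chart1 := (@chart1 R n G).
Local Notation toV := (cmap chart1).
Local Notation toG := (cinv chart1).
Implicit Types (V W : normedModType R) (phi psi f g : G -> G).

Definition zero_diff V (F : V -> G) (v : V) : Prop :=
  differentiable (toV \o F) v /\ forall u, 'd (toV \o F) v u = 0.

(** By the product rule the differential of [P Q^-1] at [v] is unchanged when [P] is replaced by
    [Q], and [Q Q^-1] is constant. The value 1 keeps all points involved in the domain of
    [chart1]. *)
Lemma zero_diff_div V (P Q : V -> G) (v : V) :
  {for v, continuous P} -> {for v, continuous Q} ->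
  differentiable (toV \o P) v -> differentiable (toV \o Q) v ->
  P v = 1%g -> Q v = 1%g ->
  (forall u, 'd (toV \o P) v u = 'd (toV \o Q) v u) ->
  zero_diff (fun u => P u * (Q u)^-1)%g v.
Proof.
move=> Pc Qc Pd Qd P1 Q1 PQ.
have U1 : cdom chart1 1%g by exact: chart1_dom1.
have PU : cdom chart1 (P v) by rewrite P1.
have QU : cdom chart1 (Q v) by rewrite Q1.
have QiU : cdom chart1 (Q v)^-1%g by rewrite Q1 invg1.
have iS : smooth_map atlasG atlasG (fun x : G => x^-1)%g by exact: lie_inv_smooth.
have [Qid _] := is_diff_smooth_comp Qc Qd iS QU QiU.
have Qic : {for v, continuous ((fun x : G => x^-1)%g \o Q)}.
  by apply: continuous_comp => //; exact: iS.1.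
have PQU : cdom chart1 (P v * (Q v)^-1)%g by rewrite P1 Q1 mulgV.
have QQU : cdom chart1 (Q v * (Q v)^-1)%g by rewrite mulgV.
have [d1 E1] := is_diff_mul Pc Qic Pd Qid PU QiU PQU.
have [d2 E2] := is_diff_mul Qc Qic Qd Qid QU QiU QQU.
split; first exact: d1.
move=> u; apply: (etrans (congr1 (fun h => h u) E1)).
have congr_mul a a' b c c' d : a = a' -> c = c' ->
  'd (@chart_mul R n G) (a, b) (c, d) = 'd (@chart_mul R n G) (a', b) (c', d).
  by move=> -> ->.
have vE : toV (P v) = toV (Q v) by rewrite P1 Q1.
apply: (etrans (congr_mul _ _ _ _ _ _ vE (PQ u))).
apply: (etrans (esym (congr1 (fun h => h u) E2))).
have -> : toV \o (fun w => Q w * (Q w)^-1)%g = cst (toV 1%g).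
  by apply: funext => w /=; rewrite mulgV.
by rewrite diff_cst.
Qed.

Lemma zero_diff_smooth_comp V (F : V -> G) g (v : V) :
  {for v, continuous F} -> smooth_map atlasG atlasG g ->
  cdom chart1 (F v) -> cdom chart1 (g (F v)) ->
  zero_diff F v -> zero_diff (g \o F) v.
Proof.
move=> Fc gS FU gFU [Fd F0].
have [d E] := is_diff_smooth_comp Fc Fd gS FU gFU.
split; first exact: d.
move=> u; apply: (etrans (congr1 (fun h => h u) E)).
by rewrite /= F0 linear0.
Qed.

Lemma zero_diff_comp V W (F : V -> G) (h : W -> V) (w : W) :
  differentiable h w -> zero_diff F (h w) -> zero_diff (F \o h) w.
Proof.
move=> hd [Fd F0]; split; first exact: (differentiable_comp hd Fd).
move=> u; apply: (etrans (congr1 (fun k => k u) (diff_comp hd Fd))).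
exact: F0.
Qed.

Lemma zero_diff_cst_near V (F : V -> G) (v : V) :
  {for v, continuous F} ->
  (\forall u \near v, cdom chart1 (F u) /\ zero_diff F u) ->
  \forall u \near v, F u = F v.
Proof.
move=> Fc /nbhs_ballP[e e0 ez]; apply/nbhs_ballP; exists e => //= u vu.
have [FuU _] := ez u vu.
have [FvU _] := ez v (ballxx v e0).
rewrite -(toVK FuU) -(toVK FvU); congr toG.
apply: (@diff0_cst_ball _ _ _ (toV \o F) v e) => // z vz.
by have [_ []] := ez z vz.
Qed.

End Rigidity.

(** * Uniqueness of smooth morphisms with a given differential *)

Section Uniqueness.
Context {R : realType} {n : nat} {G : lieGroupType R n}.
Local Notation atlasG := (@gatlas R n G).
Local Notation chart1 := (@chart1 R n G).
Local Notation toV := (cmap chart1).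
Local Notation toG := (cinv chart1).
Implicit Types (phi psi : G -> G) (gamma delta : R^o -> G).

Lemma morph_one phi : {morph phi : x y / (x * y)%g} -> phi 1%g = 1%g.
Proof. by move=> M; apply: (mulgI (phi 1%g)); rewrite -M !mulg1. Qed.

Lemma smooth_div (M : topologicalType) (V : normedModType R)
    (A : set (chart M V)) (f g : M -> G) : is_atlas A ->
  smooth_map A atlasG f -> smooth_map A atlasG g ->
  smooth_map A atlasG (fun x => f x * (g x)^-1)%g.
Proof.
move=> Aa fS gS; apply: smooth_mul => //.
apply: (smooth_map_comp _ Aa _ _ gS (@lie_inv_smooth R n G)).
- exact: row_has_coordinates.
- exact: gatlas_is_atlas.
- exact: gatlas_is_atlas.
Qed.

Lemma morph_eq_near1 phi psi :
  {morph phi : x y / (x * y)%g} -> {morph psi : x y / (x * y)%g} ->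
  smooth_map atlasG atlasG phi -> smooth_map atlasG atlasG psi ->
  differential phi =1 differential psi ->
  \forall x \near (1%g : G), phi x = psi x.
Proof.
move=> phiM psiM phiS psiS dE.
have phi1 := morph_one phiM; have psi1 := morph_one psiM.
have U1 : cdom chart1 1%g by exact: chart1_dom1.
have toG1 : toG (toV 1%g) = 1%g by rewrite toVK.
pose f (x : G) := (phi x * (psi x)^-1)%g.
have fS : smooth_map atlasG atlasG f.
  by apply: smooth_div => //; exact: gatlas_is_atlas.
have f1 : f 1%g = 1%g by rewrite /f phi1 psi1 mulgV.
have comp_toG (h : G -> G) x : continuous h -> cdom chart1 x ->
    {for toV x, continuous (h \o toG)}.
  move=> hc xU; apply: continuous_comp; first exact: toG_continuous.
  exact: hc.
have z1 : zero_diff (f \o toG) (toV 1%g).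
  apply: (@zero_diff_div _ _ _ _ (phi \o toG) (psi \o toG)).
  - by apply: comp_toG => //; exact: phiS.1.
  - by apply: comp_toG => //; exact: psiS.1.
  - by apply: smooth_differentiable => //; rewrite phi1.
  - by apply: smooth_differentiable => //; rewrite psi1.
  - by rewrite /= toG1.
  - by rewrite /= toG1.
  - exact: dE.
(* The left translation [h] takes [x] to 1, where the differential of [f] vanishes by [z1]; a
   two-sided translation then gives the vanishing at [x]. *)
have zx x : cdom chart1 x -> cdom chart1 (f x) -> zero_diff (f \o toG) (toV x).
  move=> xU fxU.
  pose h := bitranslate x^-1%g (1%g : G).
  have hS : smooth_map atlasG atlasG h by exact: smooth_bitranslate.
  have hx : h x = 1%g by rewrite /h /bitranslate mulVg mulg1.
  have htoGx : (h \o toG) (toV x) = 1%g by rewrite /= toVK.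
  have hc := comp_toG _ _ hS.1 xU.
  have hd : differentiable (toV \o (h \o toG)) (toV x).
    by apply: smooth_differentiable => //; rewrite hx.
  have z : zero_diff (f \o (h \o toG)) (toV x).
    have [||d E] := is_diff_smooth_comp hc hd fS.
    - by rewrite htoGx.
    - by rewrite htoGx f1.
    split; first exact: d.
    move=> u; apply: (etrans (congr1 (fun k => k u) E)).
    by rewrite htoGx; exact: z1.2.
  (* The relation f(x u) = phi(x) f(u) psi(x)^-1 at u = [h (toG w)]. *)
  have fE : f \o toG = bitranslate (phi x) (psi x)^-1%g \o (f \o (h \o toG)).
    apply: funext => w.
    have -> : (f \o toG) w = f (x * (h (toG w)))%g.
      by rewrite /h /bitranslate mulg1 mulVKg.
    by rewrite /f phiM psiM /bitranslate /= invgM !mulgA.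
  rewrite fE; apply: zero_diff_smooth_comp z.
  - apply: continuous_comp => //; exact: fS.1.
  - exact: smooth_bitranslate.
  - by rewrite /= toVK// hx f1.
  - have := congr1 (fun F => F (toV x)) fE.
    by rewrite /= toVK// => <-.
have Fc : {for toV 1%g, continuous (f \o toG)} by apply: comp_toG => //; exact: fS.1.
(* The image of the chart is open, so vectors near [toV 1] have the form [toV x] with [x] in the
   chart domain, as [zx] requires. *)
have fFU : \forall u \near toV 1%g, cdom chart1 ((f \o toG) u) /\ zero_diff (f \o toG) u.
  have F1U : cdom chart1 ((f \o toG) (toV 1%g)) by rewrite /= toG1 f1.
  have [_ oi _ _ _] := @chart1_is_chart R n G.
  have i1 : cimg chart1 (toV 1%g) by exists 1%g.
  apply: filterS2 (near_chart1 Fc F1U) (open_nbhs_nbhs (conj oi i1)) => u FuU [x xU xu].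
  split; first exact: FuU.
  move: FuU; rewrite -xu => FuU; apply: zx; first exact: xU.
  by rewrite -(toVK xU).
have feq := zero_diff_cst_near Fc fFU.
have [oU _ _ toVc _] := @chart1_is_chart R n G.
have fx1 : \forall x \near (1%g : G), (f \o toG) (toV x) = (f \o toG) (toV 1%g).
  exact: (toVc _ U1 _ feq).
apply: filterS2 fx1 (open_nbhs_nbhs (conj oU U1)) => x fx xU.
move: fx; rewrite /= !toVK// f1 => /eqP; rewrite divg_eq1 => /eqP.
exact.
Qed.

(** Homogeneity: left translation by [x^-1] is continuous and takes [x] to 1. *)
Lemma near_translate (P : G -> Prop) (x : G) : (\forall w \near (1%g : G), P w) ->
  \forall u \near x, P (x^-1 * u)%g.
Proof.
move=> P1.
have c := (smooth_bitranslate x^-1%g (1%g : G)).1 x.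
have E : bitranslate x^-1%g 1%g x = 1%g by rewrite /bitranslate mulVg mulg1.
have cP : \forall u \near x, P (bitranslate x^-1%g 1%g u) by apply: c; rewrite E.
apply: filterS cP => u.
by rewrite /bitranslate /= mulg1.
Qed.

Lemma morph_eq_of_differential phi psi : connected [set: G] ->
  {morph phi : x y / (x * y)%g} -> {morph psi : x y / (x * y)%g} ->
  smooth_map atlasG atlasG phi -> smooth_map atlasG atlasG psi ->
  differential phi =1 differential psi -> phi =1 psi.
Proof.
move=> Gc phiM psiM phiS psiS dE.
have near1 := morph_eq_near1 phiM psiM phiS psiS dE.
(* For [u] near [x] the morphisms agree at [x^-1 u], so agreement at [u] and at [x] are equivalent.
   Hence the agreement set and its complement are both open. *)
have near_iff x : \forall u \near x, phi u = psi u <-> phi x = psi x.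
  apply: filterS (near_translate x near1) => u E.
  rewrite -{1 2}(mulVKg x u) phiM psiM E; split=> [|->//].
  exact: mulIg.
have E : [set x | phi x = psi x] = setT.
  apply: Gc.
  - by exists 1%g => /=; rewrite (morph_one phiM) (morph_one psiM).
  - exists [set x | phi x = psi x]; last by rewrite setTI.
    rewrite openE => x /= xE.
    by apply: filterS (near_iff x) => u [_]; apply.
  - exists [set x | phi x = psi x]; last by rewrite setTI.
    rewrite -openC openE => x /= xE.
    by apply: filterS (near_iff x) => u [ux _] /ux.
by move=> x; have : [set: G] x by []; rewrite -E.
Qed.

End Uniqueness.

(** * Uniqueness of one-parameter subgroups *)

Section OneParameterSubgroups.
Context {R : realType} {n : nat} {G : lieGroupType R n}.
Local Notation atlasG := (@gatlas R n G).
Local Notation chart1 := (@chart1 R n G).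
Local Notation toV := (cmap chart1).
Local Notation toG := (cinv chart1).
Implicit Types (phi psi : G -> G) (gamma delta : R^o -> G).

Lemma one_parameter0 gamma : (forall s t, gamma (s + t) = gamma s * gamma t)%g ->
  gamma 0 = 1%g.
Proof. by move=> M; apply: (mulgI (gamma 0)); rewrite -M addr0 mulg1. Qed.

Lemma one_parameterMn gamma : (forall s t, gamma (s + t) = gamma s * gamma t)%g ->
  forall t k, gamma (t *+ k) = (gamma t ^+ k)%g.
Proof.
move=> M t; elim=> [|k IH]; first by rewrite mulr0n expg0 one_parameter0.
by rewrite mulrS M IH expgS.
Qed.

Lemma curve_differentiable gamma t : smooth_map [set id_chart R^o] atlasG gamma ->
  cdom chart1 (gamma t) -> differentiable (toV \o gamma) t.
Proof.
move=> [_ /(_ _ _ erefl (@chart1_atlas R n G) 1%N) [gd _]] gU; apply: gd.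
by split=> //; exists t.
Qed.

(** A linear map on the line is determined by its value at 1. This links [derive1], used in
    [one_parameter], to the differential. *)
Lemma diff_derive1 (F : R^o -> 'rV[R]_n) (u t : R^o) : differentiable F t ->
  'd F t u = u *: derive1 F t.
Proof.
move=> Fd; rewrite (derive1E' Fd) -linearZ.
exact: (congr1 ('d F t) (esym (mulr1 u))).
Qed.

(** The quotient of the two curves is constant near 0, by the argument used for morphisms, and every
    time is an integer multiple of a small one. *)
Lemma one_parameter_unique gamma delta X :
  one_parameter gamma X -> one_parameter delta X -> gamma =1 delta.
Proof.
move=> [gM gS gX] [dM dS dX].
have g0 := one_parameter0 gM; have d0 := one_parameter0 dM.
have U1 : cdom chart1 1%g by exact: chart1_dom1.
have gd : differentiable (toV \o gamma) 0.
  by apply: curve_differentiable => //; rewrite g0.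
have dd : differentiable (toV \o delta) 0.
  by apply: curve_differentiable => //; rewrite d0.
pose f (t : R^o) : G := (gamma t * (delta t)^-1)%g.
have fS : smooth_map [set id_chart R^o] atlasG f.
  by apply: smooth_div => //; exact: id_is_atlas.
have f0 : f 0 = 1%g by rewrite /f g0 d0 mulgV.
have z0 : zero_diff f 0.
  apply: (@zero_diff_div _ _ _ _ gamma delta _ _ _ gd dd g0 d0).
  - exact: gS.1.
  - exact: dS.1.
  move=> u; apply: (etrans (diff_derive1 u gd)).
  by apply: (etrans _ (esym (diff_derive1 u dd))); rewrite gX dX.
have zt t : cdom chart1 (f t) -> zero_diff f t.
  move=> ftU.
  pose h (u : R^o) : R^o := u - t.
  have hd : differentiable h t.
    apply: differentiableB; last exact: differentiable_cst.
    by have [] := is_diff_id t.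
  have ht : h t = 0 by rewrite /h subrr.
  have z : zero_diff (f \o h) t by apply: zero_diff_comp; rewrite ?ht.
  (* Here f(w) = gamma(t) f(w - t) delta(t)^-1, which moves the zero differential from 0 to [t]. *)
  have fE : f = bitranslate (gamma t) (delta t)^-1%g \o (f \o h).
    apply: funext => w; rewrite -[in LHS](subrK t w) addrC.
    by rewrite /f gM dM /bitranslate /= invgM !mulgA.
  rewrite {1}fE; apply: zero_diff_smooth_comp z.
  - apply: continuous_comp; last exact: fS.1.
    exact: differentiable_continuous.
  - exact: smooth_bitranslate.
  - by rewrite /= ht f0.
  - rewrite -[X in cdom _ X]/((bitranslate (gamma t) (delta t)^-1%g \o (f \o h)) t).
    by rewrite -fE.
have Fc : {for (0 : R^o), continuous f} by exact: fS.1.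
have f0U : cdom chart1 (f 0) by rewrite f0.
have feq : \forall t \near (0 : R^o), f t = f 0.
  apply: zero_diff_cst_near => //.
  by apply: filterS (near_chart1 Fc f0U) => u fuU; split; [exact: fuU|exact: zt].
move=> t.
have /nbhs_ballP[e /= e0 ball_e] := feq.
(* Archimedean choice giving |t / k| < e; the successor makes [k] nonzero by its form. *)
pose k := (Num.bound `|t / e|).+1.
have small : gamma (t / k%:R) = delta (t / k%:R).
  have : f (t / k%:R) = f 0.
    apply: ball_e; rewrite -ball_normE /= sub0r normrN normrM normfV.
    rewrite [`|k%:R|]ger0_norm ?ler0n// ltr_pdivrMr ?ltr0n// mulrC -ltr_pdivrMr//.
    rewrite -[e in _ / e]ger0_norm ?ltW// -normf_div.
    by apply: lt_le_trans (archi_boundP _) _ => //; rewrite ler_nat leqnSn.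
  by rewrite f0 => /eqP; rewrite divg_eq1 => /eqP.
have -> : t = (t / k%:R) *+ k.
  by rewrite -mulr_natr divfK// pnatr_eq0.
by rewrite (one_parameterMn gM) (one_parameterMn dM) small.
Qed.

End OneParameterSubgroups.

(** * Conjugation and the adjoint action *)

Section Conjugation.
Context {R : realType} {n : nat} {G : lieGroupType R n}.
Local Notation atlasG := (@gatlas R n G).
Local Notation chart1 := (@chart1 R n G).
Local Notation toV := (cmap chart1).
Local Notation toG := (cinv chart1).
Implicit Types (f g : G -> G) (gamma : R^o -> G) (x y : G) (X : 'rV[R]_n).

(** The chain rule at 1: both maps fix 1, so all three differentials are taken at the same point of
    the chart. *)
Lemma differential_comp f g X :
  smooth_map atlasG atlasG f -> smooth_map atlasG atlasG g ->
  f 1%g = 1%g -> g 1%g = 1%g ->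
  differential (g \o f) X = differential g (differential f X).
Proof.
move=> fS gS f1 g1; have U1 : cdom chart1 1%g by exact: chart1_dom1.
have toG1 : f (toG (toV 1%g)) = 1%g by rewrite toVK.
have fc : {for toV 1%g, continuous (f \o toG)}.
  by apply: continuous_comp; [exact: toG_continuous|exact: fS.1].
have fd : differentiable (toV \o (f \o toG)) (toV 1%g).
  by apply: smooth_differentiable => //; rewrite f1.
have [||_ E] := is_diff_smooth_comp fc fd gS.
- by rewrite /= toG1.
- by rewrite /= toG1 g1.
apply: (etrans (congr1 (fun k => k X) E)).
by rewrite /= toG1.
Qed.

Lemma differential_id X : differential (id : G -> G) X = X.
Proof.
have U1 : cdom chart1 1%g by exact: chart1_dom1.
have [_ oi _ _ _] := @chart1_is_chart R n G.
have i1 : cimg chart1 (toV 1%g) by exists 1%g.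
have E : {near toV 1%g, id =1 toV \o id \o toG}.
  apply: filterS (open_nbhs_nbhs (conj oi i1)) => _ [x xU <-].
  by rewrite /= toVK.
have [idd idE] := is_diff_id (toV (1%g : G)).
have [_ dE] := near_eq_is_diff E idd.
by apply: (etrans (congr1 (fun k => k X) dE)); rewrite idE.
Qed.

Lemma conj_one y : bitranslate y y^-1%g 1%g = 1%g.
Proof. by rewrite /bitranslate mulg1 mulgV. Qed.

(** The factor [(y^-1)^-1] is left unreduced, so that the inner map is literally the conjugation
    whose differential is [Ad y^-1]. *)
Lemma conjVK y x : bitranslate y y^-1%g (bitranslate y^-1%g (y^-1)^-1%g x) = x.
Proof. by rewrite /bitranslate invgK mulgA mulVKg mulgK. Qed.

Lemma conjKV y x : bitranslate y^-1%g (y^-1)^-1%g (bitranslate y y^-1%g x) = x.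
Proof. by rewrite /bitranslate invgK !mulgA mulVg mul1g mulgVK. Qed.

Lemma conj_morph y : {morph bitranslate y y^-1%g : x z / (x * z)%g}.
Proof. by move=> x z; rewrite /bitranslate !mulgA mulgVK. Qed.

Lemma AdVK y X : Ad y (Ad y^-1%g X) = X.
Proof.
have E := differential_comp X (smooth_bitranslate y^-1%g (y^-1)^-1%g)
  (smooth_bitranslate y y^-1%g) (conj_one y^-1%g) (conj_one y).
apply: (etrans (esym E)); rewrite -[RHS]differential_id.
by congr (differential _ X); apply: funext => x; exact: conjVK.
Qed.

Lemma one_parameter_conj gamma X y : one_parameter gamma X ->
  one_parameter (bitranslate y y^-1%g \o gamma) (Ad y X).
Proof.
move=> [gM gS gX]; have g0 := one_parameter0 gM.
have U1 : cdom chart1 1%g by exact: chart1_dom1.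
have gd : differentiable (toV \o gamma) 0.
  by apply: curve_differentiable => //; rewrite g0.
split.
- by move=> s t; rewrite /= gM conj_morph.
- have Ga := @gatlas_is_atlas R n G.
  have W := @row_has_coordinates R n.
  have Ra := @id_is_atlas R R^o.
  exact: (smooth_map_comp W Ra Ga Ga gS (smooth_bitranslate y y^-1%g)).
have [||d E] := is_diff_smooth_comp (gS.1 0) gd (smooth_bitranslate y y^-1%g).
- by rewrite g0.
- by rewrite g0 conj_one.
apply: (etrans (derive1E' d)).
apply: (etrans (congr1 (fun k => k (1 : R^o)) E)).
by rewrite /= -(derive1E' gd) gX g0.
Qed.

(** This is exp(Ad(y) X) = y exp(X) y^-1, arranged to fit [a], which is the image of [a'] under
    [Ad y^-1]. *)
Lemma exp_set_conj (S : set 'rV[R]_n) y x :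
  exp_set S (bitranslate y y^-1%g x) <-> exp_set (Ad y^-1%g @` S) x.
Proof.
split=> [[X SX [gamma gX E]]|[_ [X SX <-] [gamma gX ->]]].
  exists (Ad y^-1%g X); first by exists X.
  exists (bitranslate y^-1%g (y^-1)^-1%g \o gamma); first exact: one_parameter_conj.
  by rewrite /= -E conjKV.
exists X => //; exists (bitranslate y y^-1%g \o gamma) => //.
by rewrite -[X](AdVK y); exact: one_parameter_conj.
Qed.

Lemma starVK y (p : G * G) : star y (star y^-1%g p) = p.
Proof. by case: p => a b; congr pair; exact: conjVK. Qed.

Lemma act_star y p x :
  act (star y p) (bitranslate y y^-1%g x) = bitranslate y y^-1%g (act p x).
Proof. by rewrite /act /star /bitranslate /= !invgM invgK !mulgA !mulgVK. Qed.

(** * Transport of normalizers and centralizers by conjugation *)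

Section Transport.
Variables (y : G) (L L' H C C' : set G).
(** Pointwise forms of L' = y L y^-1, H = y H y^-1 and C' = y C y^-1. *)
Hypothesis LE : forall x, L' (bitranslate y y^-1%g x) <-> L x.
Hypothesis HE : forall x, H (bitranslate y y^-1%g x) <-> H x.
Hypothesis CE : forall x, C' (bitranslate y y^-1%g x) <-> C x.

Lemma setX_star p : (L' `*` H) (star y p) <-> (L `*` H) p.
Proof. by split=> -[/LE ? /HE ?]. Qed.

Lemma image_conj_set : C' = bitranslate y y^-1%g @` C.
Proof.
apply/seteqP; split=> [x C'x|_ [x Cx <-]]; last exact/CE.
by exists (bitranslate y^-1%g (y^-1)^-1%g x); [apply/CE|]; rewrite conjVK.
Qed.

Lemma eq_image_star (P P' : set (G * G)) :
  (forall p, P' (star y p) <-> P p) -> P' = star y @` P.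
Proof.
move=> PE; apply/seteqP; split=> [p P'p|_ [p Pp <-]]; last exact/PE.
by exists (star y^-1%g p); [apply/PE|]; rewrite starVK.
Qed.

Lemma normalizer_conj : normalizer L' H C' = star y @` normalizer L H C.
Proof.
apply: eq_image_star => p; rewrite /normalizer /=.
have E : act (star y p) @` C' = bitranslate y y^-1%g @` (act p @` C).
  by rewrite image_conj_set !image_comp; apply: eq_imagel => x _; exact: act_star.
rewrite E image_conj_set; split=> -[/setX_star ? Ep]; split=> //; last by rewrite Ep.
(* Conjugation by [y] is injective on sets: its inverse is applied to both sides of [Ep]. *)
have := congr1 (fun S => bitranslate y^-1%g (y^-1)^-1%g @` S) Ep.
have K : bitranslate y^-1%g (y^-1)^-1%g \o bitranslate y y^-1%g = id.
  by apply: funext => x; exact: conjKV.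
by rewrite !image_comp K image_id.
Qed.

Lemma centralizer_conj : centralizer L' H C' = star y @` centralizer L H C.
Proof.
apply: eq_image_star => p; rewrite /centralizer /= image_conj_set.
split=> -[/setX_star ? fixp]; split=> //.
  move=> x Cx; have := fixp (bitranslate y y^-1%g x); rewrite act_star.
  move=> /(_ (ex_intro2 _ _ x Cx erefl)).
  by move=> /(congr1 (bitranslate y^-1%g (y^-1)^-1%g)); rewrite !conjKV.
by move=> _ [x Cx <-]; rewrite act_star fixp.
Qed.

End Transport.

(** By the chain rule the conjugate of [theta] by [y] has the differential that is prescribed for
    [theta']; on a connected group the two morphisms then coincide. *)
Lemma involution_conj (theta theta' : G -> G) y : connected [set: G] ->
  involutive_automorphism theta -> involutive_automorphism theta' ->
  (forall X, differential theta' X = Ad y (differential theta (Ad y^-1%g X))) ->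
  forall x, theta' (bitranslate y y^-1%g x) = bitranslate y y^-1%g (theta x).
Proof.
move=> Gc [tM tS _] [t'M t'S _] dE x.
pose c := bitranslate y y^-1%g; pose c' := bitranslate y^-1%g (y^-1)^-1%g.
have Ga := @gatlas_is_atlas R n G.
have cS : smooth_map atlasG atlasG c by exact: smooth_bitranslate.
have c'S : smooth_map atlasG atlasG c' by exact: smooth_bitranslate.
have tc'S : smooth_map atlasG atlasG (theta \o c').
  exact: (smooth_map_comp (@row_has_coordinates R n) Ga Ga Ga c'S tS).
have ctc'S : smooth_map atlasG atlasG (c \o (theta \o c')).
  exact: (smooth_map_comp (@row_has_coordinates R n) Ga Ga Ga tc'S cS).
have c'1 : c' 1%g = 1%g by exact: conj_one.
have t1 := morph_one tM.
have tc'1 : (theta \o c') 1%g = 1%g by rewrite /= c'1.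
have -> : theta' = c \o (theta \o c').
  apply/funext; apply: (morph_eq_of_differential Gc t'M _ t'S ctc'S).
    by move=> u v; rewrite /= /c' conj_morph tM /c conj_morph.
  move=> X; apply: (etrans (dE X)); apply/esym.
  apply: (etrans (differential_comp X tc'S cS tc'1 (conj_one y))).
  by congr (differential c _); exact: differential_comp X c'S tS c'1 t1.
by rewrite /= /c' conjKV.
Qed.

End Conjugation.

Theorem proposition3p4 (R : realType) (n : nat) (G : lieGroupType R n)
  (G_connected : connected [set: G])
  (G_noncompact : ~ compact [set: G])
  (G_semisimple : semisimple G)
  (sigma : G -> G) (sigma_invol : involutive_automorphism sigma)
  (H : set G) (H_subgroup : is_subgroup H) (H_closed : closed H)
  (H_lower : connected_component (fixed sigma) 1%g `<=` H)
  (H_upper : H `<=` fixed sigma)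
  (theta theta' : G -> G)
  (theta_cartan : cartan_involution theta)
  (theta'_cartan : cartan_involution theta')
  (theta_sigma : forall g, theta (sigma g) = sigma (theta g))
  (theta'_sigma : forall g, theta' (sigma g) = sigma (theta' g))
  (y : G) (y_exp : exp_set (lie_subalgebra H) y)
  (y_theta : forall X : 'rV[R]_n,
     differential theta' X = Ad y (differential theta (Ad (y^-1)%g X)))
  (a' : {vspace 'rV[R]_n})
  (a'_maximal :
     maximal_abelian_subspace G (anti_fixed theta' `&` anti_fixed sigma) a') :
  let K := fixed theta in
  let K' := fixed theta' in
  let a := Ad (y^-1)%g @` [set` a'] in
  let A' := exp_set [set` a'] : set G in
  let A := exp_set a : set G in
  normalizer K' H A' = star y @` normalizer K H A /\
  centralizer K' H A' = star y @` centralizer K H A.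
Proof.
have [_ HM HV] := H_subgroup.
(* Membership of [X] in the Lie algebra of [H] supplies a curve [delta] inside [H], while [y] is the
   endpoint of a curve [gamma] that is only known to have the same velocity; uniqueness identifies
   the two. *)
have yH : H y.
  have [X [delta deltaX deltaH] [gamma gammaX ->]] := y_exp.
  by rewrite (one_parameter_unique gammaX deltaX).
have KE := involution_conj G_connected theta_cartan.1 theta'_cartan.1 y_theta.
move=> K K' a A' A.
have K'E x : K' (bitranslate y y^-1%g x) <-> K x.
  rewrite /K' /K /fixed /= KE; split=> [|->//].
  by move=> /(congr1 (bitranslate y^-1%g (y^-1)^-1%g)); rewrite !conjKV.
(* As [y] lies in the subgroup [H], conjugations by [y] and by [y^-1] both preserve [H]. *)
have HE x : H (bitranslate y y^-1%g x) <-> H x.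
  split=> Hx; last exact: HM _ _ (HM _ _ yH Hx) (HV _ yH).
  rewrite -(conjKV y x) /bitranslate invgK.
  exact: HM _ _ (HM _ _ (HV _ yH) Hx) yH.
have A'E x : A' (bitranslate y y^-1%g x) <-> A x by exact: exp_set_conj.
by split; [exact: normalizer_conj|exact: centralizer_conj].
Qed.
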